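(* Let $(\mathcal{P}_1,\mathcal{L}_1)$ and $(\mathcal{P}_2,\mathcal{L}_2)$ be configurations of order $1$ of types $((n_1)_{s_1},(m_1)_{t_1})$ and $((n_2)_{s_2},(m_2)_{t_2})$ respectively. Then their cartesian product $(\mathcal{P},\mathcal{E})$ is well-defined as a configuration of higher order: it is a configuration of order $\max\{t_1,t_2\}$, and it is of type $((n_1n_2)_{s_1s_2},(m_1m_2)_{t_1t_2})$; that is, it has $n_1n_2$ points, each incident with exactly $s_1s_2$ planes, and $m_1m_2$ planes, each incident with exactly $t_1t_2$ points.
   Context: A configuration of order $1$ is a pair $(\mathcal{P},\mathcal{L})$, where $\mathcal{P}$ is a finite set of points and $\mathcal{L}$ is a finite set of subsets of $\mathcal{P}$ called lines, such that any two distinct points are contained together in at most one line, every point is in the same number $s$ of lines, every line contains the same number $t$ of points, and $s,t\ge 2$. It is of type $(n_s,m_t)$ if it has $n$ points and $m$ lines with these $s$ and $t$. A configuration of order $k$ is a pair $(\mathcal{P},\mathcal{E})$, where $\mathcal{P}$ is a finite set of points and $\mathcal{E}$ is a finite set of subsets of $\mathcal{P}$ called $k$-planes (or planes), such that any $k+1$ distinct points are contained together in at most one plane, every point is in the same number $s$ of planes, every plane contains the same number $t$ of points, $s,t\ge k+1$, and some collection of $k$ points is contained in more than one plane. Type $(n_s,m_t)$ means $n$ points and $m$ planes with these $s$ and $t$. The cartesian product of $(\mathcal{P}_1,\mathcal{L}_1)$ and $(\mathcal{P}_2,\mathcal{L}_2)$ is $(\mathcal{P},\mathcal{E})$ with $\mathcal{P}=\mathcal{P}_1\times\mathcal{P}_2$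 and $\mathcal{E}=\{l_1\times l_2 : l_1\in\mathcal{L}_1,\ l_2\in\mathcal{L}_2\}$.
   Formalization: The product is claimed to be a configuration of order max{t1,t2} only when s1s2 ≥ max{t1,t2}+1 (this fails for the 4×4 grid times itself); the type and all other defining conditions are stated without that assumption; both point sets are assumed nonempty. *)

(* Defs.v *)
(* MathComp.  A configuration is given by a finType T of points together with
   its set E of blocks (lines or planes). *)
From mathcomp Require Import all_boot.

Set Implicit Arguments.
Unset Strict Implicit.
Unset Printing Implicit Defensive.

Definition degree_is (T : finType) (E : {set {set T}}) (s : nat) : Prop :=
  forall x : T, #|[set e in E | x \in e]| = s.

Definition block_size_is (T : finType) (E : {set {set T}}) (t : nat) : Prop :=
  forall e : {set T}, e \in E -> #|e| = t.

Definition at_most_one_block (T : finType) (E : {set {set T}}) (r : nat) : Prop :=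
  forall A : {set T}, #|A| = r -> #|[set e in E | A \subset e]| <= 1.

Definition some_in_several_blocks (T : finType) (E : {set {set T}}) (r : nat)
    : Prop :=
  exists A : {set T}, #|A| = r /\ 1 < #|[set e in E | A \subset e]|.

Definition is_configuration1 (T : finType) (L : {set {set T}}) : Prop :=
  at_most_one_block L 2 /\
  exists s t : nat, [/\ degree_is L s, block_size_is L t, 2 <= s & 2 <= t].

(* The bound k.+1 <= s can fail for a cartesian product: the rows and columns of
   the 4 x 4 grid form an order-1 configuration with s = 2 and t = 4, and its
   product with itself has s = 4 where k = max 4 4 = 4 asks for s >= 5. *)
Definition is_configuration (k : nat) (T : finType) (E : {set {set T}}) : Prop :=
  [/\ at_most_one_block E k.+1,
      exists s t : nat,
        [/\ degree_is E s, block_size_is E t, k.+1 <= s & k.+1 <= t]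
    & some_in_several_blocks E k].

(* Type (n_s, m_t).  When T is empty, s and t are not determined by E. *)
Definition has_type (T : finType) (E : {set {set T}}) (n s m t : nat) : Prop :=
  [/\ #|T| = n, degree_is E s, #|E| = m & block_size_is E t].

Definition cartesian_product (T1 T2 : finType)
    (L1 : {set {set T1}}) (L2 : {set {set T2}}) : {set {set T1 * T2}} :=
  [set setX l1 l2 | l1 in L1, l2 in L2].

(* Main.v *)
(* Let A be a set of more than max t1 t2 points of a plane l1 x l2.  Each
   projection of A has at least two points: if one were a single point, A would
   be no larger than a line.  Two points of a line determine it, so A determines
   l1 and l2.  Conversely, if l1 is a line of maximal size, then l1 x {x2} lies
   in the plane l1 x l for each of the at least two lines l through x2. *)
Require Import Defs.
From mathcomp Require Import all_boot.

Lemma imset_fst_setX (T1 T2 : finType) (A : {set T1}) (B : {set T2}) :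
  B != set0 -> [set x.1 | x in setX A B] = A.
Proof.
case/set0Pn=> b Bb; apply/setP=> a; apply/imsetP/idP => [[x]|Aa].
  by rewrite inE => /andP[Ax _] ->.
by exists (a, b) => //; rewrite in_setX Aa.
Qed.

Lemma imset_snd_setX (T1 T2 : finType) (A : {set T1}) (B : {set T2}) :
  A != set0 -> [set x.2 | x in setX A B] = B.
Proof.
case/set0Pn=> a Aa; apply/setP=> b; apply/imsetP/idP => [[x]|Bb].
  by rewrite inE => /andP[_ Bx] ->.
by exists (a, b) => //; rewrite in_setX Aa.
Qed.

(** The two projections of a product of nonempty sets recover its factors, so pairs of blocks inject
    into products. An empty block on either side would send different pairs to the empty set. *)
Lemma card_cartesian_product (T1 T2 : finType)
    (L1 : {set {set T1}}) (L2 : {set {set T2}}) :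
    set0 \notin L1 -> set0 \notin L2 ->
  #|cartesian_product L1 L2| = #|L1| * #|L2|.
Proof.
move=> L1n0 L2n0; rewrite /cartesian_product curry_imset2X card_in_imset ?cardsX //.
case=> [a b] [c d]; rewrite !in_setX => /andP[aL bL] /andP[cL dL] /= abcd.
have n0 (T : finType) (L : {set {set T}}) e : set0 \notin L -> e \in L -> e != set0.
  by move=> Ln0 eL; apply: contraNneq Ln0 => <-.
have := imset_fst_setX _ _ a _ (n0 _ _ _ L2n0 bL).
have := imset_snd_setX _ _ _ b (n0 _ _ _ L1n0 aL).
by rewrite abcd imset_fst_setX ?imset_snd_setX ?(n0 _ _ _ L1n0 cL) ?(n0 _ _ _ L2n0 dL) // => -> ->.
Qed.

(** Reduces the degree of a point to the size of a product, which [card_cartesian_product]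
    computes. *)
Lemma cartesian_product_through (T1 T2 : finType)
    (L1 : {set {set T1}}) (L2 : {set {set T2}}) (x : T1 * T2) :
  [set e in cartesian_product L1 L2 | x \in e]
    = cartesian_product [set e in L1 | x.1 \in e] [set e in L2 | x.2 \in e].
Proof.
apply/setP=> e; rewrite inE; apply/andP/imset2P => [[/imset2P[a b aL bL ->]]|[a b]].
  by rewrite inE => /andP[xa xb]; exists a b; rewrite ?inE ?aL ?bL.
rewrite !inE => /andP[aL xa] /andP[bL xb] ->; split; last by rewrite inE xa.
exact: imset2_f.
Qed.

Lemma block_size_set0 {T : finType} {L : {set {set T}}} {t : nat} :
  block_size_is L t -> 0 < t -> set0 \notin L.
Proof. by move=> Lt t0; apply/negP=> /Lt; rewrite cards0 => t0E; rewrite -t0E in t0. Qed.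

Lemma cartesian_product_type {T1 T2 : finType}
    {L1 : {set {set T1}}} {L2 : {set {set T2}}} {n1 s1 m1 t1 n2 s2 m2 t2 : nat} :
    0 < t1 -> 0 < t2 -> has_type L1 n1 s1 m1 t1 -> has_type L2 n2 s2 m2 t2 ->
  has_type (cartesian_product L1 L2) (n1 * n2) (s1 * s2) (m1 * m2) (t1 * t2).
Proof.
move=> t1_gt0 t2_gt0 [<- deg1 <- bs1] [<- deg2 <- bs2].
have L1n0 := block_size_set0 bs1 t1_gt0; have L2n0 := block_size_set0 bs2 t2_gt0.
split; rewrite ?card_prod ?card_cartesian_product //.
  move=> x; rewrite cartesian_product_through card_cartesian_product ?deg1 ?deg2 //.
    by rewrite inE negb_and L1n0.
  by rewrite inE negb_and L2n0.
by move=> _ /imset2P[a b aL bL ->]; rewrite cardsX bs1 ?bs2.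
Qed.

(** The bounds in [is_configuration1] concern existentially quantified parameters. A point, and then
    a line through it, identify these with the [s] and [t] of the type. *)
Lemma configuration1_ge2 {T : finType} {L : {set {set T}}} {n s m t : nat} :
    0 < n -> is_configuration1 L -> has_type L n s m t ->
  1 < s /\ 1 < t.
Proof.
move=> n_gt0 [_ [s' [t' [deg' bs' s'2 t'2]]]] [nE deg _ bs].
have /card_gt0P[x _] : 0 < #|T| by rewrite nE.
have sE : s' = s by rewrite -(deg' x) deg.
have /card_gt0P[e] : 0 < #|[set e in L | x \in e]| by rewrite deg' ltnW.
by rewrite inE => /andP[eL _]; rewrite -sE -(bs e eL) bs'.
Qed.

Lemma at_most_one_block_eq {T : finType} {L : {set {set T}}} {r : nat}
    {A e f : {set T}} :
    at_most_one_block L r -> r <= #|A| ->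
    e \in L -> f \in L -> A \subset e -> A \subset f ->
  e = f.
Proof.
move=> L1 rA eL fL Ae Af.
(* The hypothesis on [L] concerns sets of exactly [r] points, so [A] is cut down to [r] distinct
   elements. *)
have /card_geqP[s [us sr sA]] := rA.
have BA : [set:: s] \subset A by apply/subsetP=> x; rewrite inE => /sA.
have cardB : #|[set:: s]| = r by rewrite -sr cardsE; apply/card_uniqP.
have /card_le1_eqP := L1 _ cardB; apply.
  by rewrite inE fL (subset_trans BA).
by rewrite inE eL (subset_trans BA).
Qed.

Lemma cartesian_product_at_most_one_block {T1 T2 : finType}
    {L1 : {set {set T1}}} {L2 : {set {set T2}}} {t1 t2 : nat} :
    at_most_one_block L1 2 -> at_most_one_block L2 2 ->
    block_size_is L1 t1 -> block_size_is L2 t2 ->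
  at_most_one_block (cartesian_product L1 L2) (maxn t1 t2).+1.
Proof.
move=> one1 one2 bs1 bs2 A cardA; apply/card_le1_eqP => e f.
rewrite !inE => /andP[/imset2P[a b aL bL ->] Aab] /andP[/imset2P[c d cL dL ->] Acd].
set P := [set x.1 | x in A]; set Q := [set x.2 | x in A].
have subP l1 (l2 : {set T2}) : A \subset setX l1 l2 -> P \subset l1.
  move/subsetP=> sA; apply/subsetP=> _ /imsetP[x /sA xl ->].
  by move: xl; rewrite inE => /andP[].
have subQ (l1 : {set T1}) l2 : A \subset setX l1 l2 -> Q \subset l2.
  move/subsetP=> sA; apply/subsetP=> _ /imsetP[x /sA xl ->].
  by move: xl; rewrite inE => /andP[].
(* [A] lies in the product of its projections [P] and [Q]. *)
have APQ : #|A| <= #|P| * #|Q|.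
  rewrite -cardsX subset_leq_card //; apply/subsetP=> x xA.
  by rewrite inE !imset_f.
have Pt : #|P| <= t1 by rewrite -(bs1 a aL) subset_leq_card ?(subP _ _ Aab).
have Qt : #|Q| <= t2 by rewrite -(bs2 b bL) subset_leq_card ?(subQ _ _ Aab).
(* Otherwise [A] would have at most [t2] points, fewer than [(maxn t1 t2).+1]. *)
have P2 : 1 < #|P|.
  rewrite ltnNge; apply/negP=> P1.
  have := leq_trans APQ (leq_mul P1 Qt).
  by rewrite cardA mul1n ltnNge leq_maxr.
have Q2 : 1 < #|Q|.
  rewrite ltnNge; apply/negP=> Q1.
  have := leq_trans APQ (leq_mul Pt Q1).
  by rewrite cardA muln1 ltnNge leq_maxl.
by rewrite (at_most_one_block_eq one1 P2 aL cL (subP _ _ Aab) (subP _ _ Acd))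
  (at_most_one_block_eq one2 Q2 bL dL (subQ _ _ Aab) (subQ _ _ Acd)).
Qed.

(** A block containing [a] times a block containing [b] contains [setX a b]. Since the blocks are
    nonempty, different pairs give different planes. *)
Lemma cartesian_product_in_several_blocks {T1 T2 : finType}
    {L1 : {set {set T1}}} {L2 : {set {set T2}}} {a : {set T1}} {b : {set T2}} :
    set0 \notin L1 -> set0 \notin L2 ->
    1 < #|[set e in L1 | a \subset e]| * #|[set e in L2 | b \subset e]| ->
  some_in_several_blocks (cartesian_product L1 L2) (#|a| * #|b|).
Proof.
move=> L1n0 L2n0 ab; exists (setX a b); rewrite cardsX; split=> //.
apply: leq_trans ab _; rewrite -card_cartesian_product ?inE ?negb_and ?L1n0 ?L2n0 //.
apply/subset_leq_card/subsetP=> e /imset2P[c d].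
rewrite !inE => /andP[cL ac] /andP[dL bd] ->.
by rewrite imset2_f //= setXS.
Qed.

Lemma card_blocks_through_block_gt0 {T : finType} {L : {set {set T}}} {e : {set T}} :
  e \in L -> 0 < #|[set f in L | e \subset f]|.
Proof. by move=> eL; apply/card_gt0P; exists e; rewrite inE eL subxx. Qed.

Lemma card_blocks_through_point {T : finType} {L : {set {set T}}} {x : T} :
  #|[set e in L | [set x] \subset e]| = #|[set e in L | x \in e]|.
Proof. by apply: eq_card => e; rewrite !inE sub1set. Qed.

Theorem proposition7p5 (T1 T2 : finType)
    (L1 : {set {set T1}}) (L2 : {set {set T2}})
    (n1 s1 m1 t1 n2 s2 m2 t2 : nat)
    (n1_gt0 : 0 < n1) (n2_gt0 : 0 < n2)
    (conf1 : is_configuration1 L1) (type1 : has_type L1 n1 s1 m1 t1)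
    (conf2 : is_configuration1 L2) (type2 : has_type L2 n2 s2 m2 t2) :
  [/\ has_type (cartesian_product L1 L2)
        (n1 * n2) (s1 * s2) (m1 * m2) (t1 * t2),
      at_most_one_block (cartesian_product L1 L2) (maxn t1 t2).+1,
      some_in_several_blocks (cartesian_product L1 L2) (maxn t1 t2),
      (maxn t1 t2).+1 <= t1 * t2
    & (maxn t1 t2).+1 <= s1 * s2 ->
      is_configuration (maxn t1 t2) (cartesian_product L1 L2)].
Proof.
have [s1_gt1 t1_gt1] := configuration1_ge2 n1_gt0 conf1 type1.
have [s2_gt1 t2_gt1] := configuration1_ge2 n2_gt0 conf2 type2.
have t1_gt0 := ltnW t1_gt1; have t2_gt0 := ltnW t2_gt1.
have typeP := cartesian_product_type t1_gt0 t2_gt0 type1 type2.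
case: (type1) (type2) => n1E deg1 _ bs1 [n2E deg2 _ bs2].
have oneP := cartesian_product_at_most_one_block conf1.1 conf2.1 bs1 bs2.
have L1n0 := block_size_set0 bs1 t1_gt0; have L2n0 := block_size_set0 bs2 t2_gt0.
have /card_gt0P[x1 _] : 0 < #|T1| by rewrite n1E.
have /card_gt0P[x2 _] : 0 < #|T2| by rewrite n2E.
have /card_gt0P[l1] : 0 < #|[set e in L1 | x1 \in e]| by rewrite deg1 ltnW.
have /card_gt0P[l2] : 0 < #|[set e in L2 | x2 \in e]| by rewrite deg2 ltnW.
rewrite !inE => /andP[l2L _] /andP[l1L _].
have severalP : some_in_several_blocks (cartesian_product L1 L2) (maxn t1 t2).
  case: leqP => _.
    (* Here the maximum is [t2], and the witness is [setX [set x1] l2]: at least two lines pass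
       through [x1], and [l2] itself contains [l2]. *)
    rewrite -(bs2 l2 l2L) -[#|l2|]mul1n -(cards1 x1).
    apply: cartesian_product_in_several_blocks => //.
    rewrite card_blocks_through_point deg1.
    exact: leq_trans s1_gt1 (leq_pmulr _ (card_blocks_through_block_gt0 l2L)).
  (* Now [t1] is the maximum, and the witness is [setX l1 [set x2]]. *)
  rewrite -(bs1 l1 l1L) -[#|l1|]muln1 -(cards1 x2).
  apply: cartesian_product_in_several_blocks => //.
  rewrite card_blocks_through_point deg2.
  exact: leq_trans s2_gt1 (leq_pmull _ (card_blocks_through_block_gt0 l1L)).
(* Each of [t1] and [t2] is multiplied by a factor of at least 2. *)
have tP : maxn t1 t2 < t1 * t2 by rewrite gtn_max ltn_Pmulr // ltn_Pmull.
(* The degree bound in [is_configuration] is the assumption [sP]; its other clauses are established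
   above. *)
split=> // sP; split=> //; exists (s1 * s2), (t1 * t2).
by case: typeP => _ degP _ bsP; split.
Qed.
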